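(* The following two statements are equivalent. (1) For all integers $k,w\geq 1$, $f(k,w)=k^{w-1}$. (2) For every integer $w\geq 1$ and all integers $1\leq k_1\leq\cdots\leq k_w$, $f(k_1,\ldots,k_w;w)=k_2\cdots k_w$ (for $w=1$ the product is empty and equals $1$).
   Context: Vectors are elements of $\mathbb{Z}^w$; $A[i]$ denotes the $i$th coordinate of $A\in\mathbb{Z}^w$, $1\leq i\leq w$. For $A,B\in\mathbb{Z}^w$, $A\leq B$ means $A[i]\leq B[i]$ for every coordinate $i$ (product order); antichains in $\mathbb{Z}^w$ are with respect to this order. For $w\geq 1$ and integers $1\leq k_1\leq\cdots\leq k_w$, vectors $A,B\in\mathbb{Z}^w$ are $(k_1,\ldots,k_w)$-crossing if there are two coordinates $i$ and $j$ with $A[i]-B[i]\geq k_i$ and $B[j]-A[j]\geq k_j$. A family is $(k_1,\ldots,k_w)$-crossing-free if it contains no two $(k_1,\ldots,k_w)$-crossing vectors. $f(k_1,\ldots,k_w;w)$ denotes the maximum size of a $(k_1,\ldots,k_w)$-crossing-free antichain in $\mathbb{Z}^w$. For positive integers $k,w$, $f(k,w)=f(k,\ldots,k;w)$, i.e. $f(k,w)$ is the maximum size of an antichain in $\mathbb{Z}^w$ containing no two vectors $A,B$ for which there are coordinates $i,j$ with $A[i]-B[i]\geq k$ and $B[j]-A[j]\geq k$. *)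

(* Defs.v *)
From mathcomp Require Import all_boot all_order all_algebra.
From mathcomp Require Import classical_sets cardinality.

Set Implicit Arguments.
Unset Strict Implicit.
Unset Printing Implicit Defensive.

Local Open Scope classical_set_scope.
Local Open Scope card_scope.
Local Open Scope ring_scope.

Section CrossingFreeAntichains.
Context {w : nat}.
Implicit Types (A B : 'rV[int]_w) (F : set 'rV[int]_w) (k : 'I_w -> nat).

Definition vec_le A B : Prop := forall i, A ord0 i <= B ord0 i.

Definition antichain F : Prop :=
  forall A B, F A -> F B -> vec_le A B -> A = B.

Definition crossing k A B : Prop :=
  exists i j : 'I_w,
    (k i)%:Z <= A ord0 i - B ord0 i /\ (k j)%:Z <= B ord0 j - A ord0 j.

Definition crossing_free k F : Prop :=
  forall A B, F A -> F B -> ~ crossing k A B.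

(* [max_size k n] is the equation f(k_1, ..., k_w; w) = n: the maximum exists
   and equals n. The upper bound ranges over infinite families as well. *)
Definition max_size k (n : nat) : Prop :=
  (exists F, [/\ antichain F, crossing_free k F & F #= `I_n])
  /\ (forall F, antichain F -> crossing_free k F -> F #<= `I_n).

End CrossingFreeAntichains.

(* Main.v *)
(* Only the upper bound in (2) needs (1). Put c = k_1, which is at most every
   k_i. The integers x with (x mod k_i) < c have density c / k_i; numbering them
   consecutively is an increasing map under which a gap of at least c can only
   come from a gap of at least k_i. If, after a shift t, all coordinates of the
   vectors of a family lie in these sets, then the numbering turns a
   (k_1, ..., k_w)-crossing-free antichain into a c-crossing-free one. Averaging
   over all shifts t in [0, k_1) x ... x [0, k_w) yields
   |F| c^w <= c^(w-1) k_1 ... k_w.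
   The lower bound is attained by the vectors (- (t_2 + ... + t_w), t_2, ..., t_w)
   with 0 <= t_i < k_i: only their first coordinates can differ by much. *)

Require Import Defs.
From mathcomp Require Import all_boot all_order all_algebra.
From mathcomp Require Import finmap classical_sets functions cardinality zify.

Set Implicit Arguments.
Unset Strict Implicit.
Unset Printing Implicit Defensive.

Import Order.TTheory GRing.Theory Num.Theory.

Local Open Scope ring_scope.

Definition in_window (c k : nat) (x : int) : bool := (x %% k)%Z < c%:Z.

(* The increasing numbering of the integers satisfying [in_window c k]. *)
Definition squeeze (c k : nat) (x : int) : int :=
  (x %/ k)%Z * c%:Z + (x %% k)%Z.

(** On the window the remainder is below both [c] and [k], so [q * c + r] and [q * k + r] both order
    the pairs [(q, r)] lexicographically. *)
Lemma squeeze_le (c k : nat) (x y : int) : (0 < k)%N ->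
  in_window c k x -> in_window c k y -> squeeze c k x <= squeeze c k y -> x <= y.
Proof.
rewrite /in_window /squeeze => k_gt0.
have k_neq0 : k%:Z != 0 by lia.
move: (modz_ge0 x k_neq0) (modz_ge0 y k_neq0) (divz_eq x k) (divz_eq y k).
have := ltz_pmod x (d := k%:Z) k_gt0; have := ltz_pmod y (d := k%:Z) k_gt0.
move: (x %/ k)%Z (x %% k)%Z (y %/ k)%Z (y %% k)%Z => q r q' r'.
move=> ? ? ? ? -> -> ? ? le_s; have : q <= q' by nia.
rewrite le_eqVlt => /predU1P[eqq|ltq]; [move: le_s; rewrite eqq; lia | nia].
Qed.

(** Remainders in the window differ by less than [c], so the quotients must differ. If they differ
    by exactly 1, the hypothesis forces [r' <= r]; if by more, the remainders cannot make up for the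
    extra [k]. *)
Lemma squeeze_gap (c k : nat) (x y : int) : (0 < k)%N ->
  in_window c k x -> in_window c k y ->
  c%:Z <= squeeze c k x - squeeze c k y -> k%:Z <= x - y.
Proof.
rewrite /in_window /squeeze => k_gt0.
have k_neq0 : k%:Z != 0 by lia.
move: (modz_ge0 x k_neq0) (modz_ge0 y k_neq0) (divz_eq x k) (divz_eq y k).
have := ltz_pmod x (d := k%:Z) k_gt0; have := ltz_pmod y (d := k%:Z) k_gt0.
move: (x %/ k)%Z (x %% k)%Z (y %/ k)%Z (y %% k)%Z => q r q' r'.
move=> ? ? ? ? -> -> ? ? le_s; have : q' + 1 <= q by nia.
rewrite le_eqVlt => /predU1P[eqq|ltq]; [move: le_s; rewrite -eqq; nia | nia].
Qed.

(** The map sending [t] to [(a + t) mod k] permutes the residues, and [c] of these lie below [c]. *)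
Lemma card_window (c k : nat) (a : int) : (c <= k)%N ->
  #|[set t : 'I_k | in_window c k (a + t%:Z)]| = c.
Proof.
case: k => [|k] le_ck.
  by move: le_ck; rewrite leqn0 => /eqP ->; apply: eq_card0 => -[].
have mod_ge0 (x : int) : 0 <= (x %% k.+1)%Z by apply: modz_ge0.
have mod_lt (x : int) : (`|(x %% k.+1)%Z|%N < k.+1)%N.
  by rewrite -ltz_nat gez0_abs // ltz_pmod.
pose f (t : 'I_k.+1) := Ordinal (mod_lt (a + t%:Z)).
have f_inj : injective f.
  move=> s t /(congr1 val)/(congr1 Posz) /=; rewrite !gez0_abs // => /eqP.
  rewrite eqz_modDl !modz_small ?ltz_nat ?ltn_ord // => /eqP[].
  exact: val_inj.
transitivity #|f @^-1: [set t : 'I_k.+1 | (t < c)%N]|.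
  by apply: eq_card => t; rewrite !inE /= -ltz_nat gez0_abs.
rewrite card_preimset // -sum1_card; under eq_bigl do rewrite inE.
by rewrite (big_ord_narrow le_ck) sum1_card card_ord.
Qed.

(** Reduces bounds on possibly infinite families to finite subfamilies, over which one can sum; an
    infinite set would contain [n.+1] elements. *)
Lemma card_le_IIP (T : choiceType) (A : set T) (n : nat) :
  (A #<= `I_n)%card <->
  forall X : {fset T}, ([set` X] `<=` A)%classic -> (#|` X| <= n)%N.
Proof.
split=> [leAn X XA|leXn].
  rewrite -(set_fsetK X); apply: geq_card_fset_set.
  exact: card_le_trans (subset_card_le XA) leAn.
have [finA|] := boolp.pselect (finite_set A); last first.
  move=> /(@infinite_set_fset _ _ n.+1)[X /leXn leX /leq_trans/(_ leX)].
  by rewrite ltnn.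
have /finite_setP[m Am] := finA.
rewrite (card_le_eql Am) card_le_II -(card_fset_set Am).
by apply: leXn; rewrite fset_setK.
Qed.

(** Double counting of the pairs of a vector [A] in [X] and a shift [t] that moves every coordinate
    of [A] into its window: each [A] has [c ^ w] such shifts, and each [t] serves at most [n]
    vectors. *)
Lemma crossing_free_card_mul (w c n : nat) (k : 'I_w -> nat) :
  (0 < c)%N -> (forall i, c <= k i)%N ->
  (forall F : set 'rV[int]_w,
     antichain F -> crossing_free (fun=> c) F -> F #<= `I_n)%card ->
  forall F : set 'rV[int]_w, antichain F -> crossing_free k F ->
  forall X : {fset 'rV[int]_w}, ([set` X] `<=` F)%classic ->
    (#|` X| * c ^ w <= n * \prod_i k i)%N.
Proof.
move=> c_gt0 le_ck bound F antiF freeF X XF.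
have k_gt0 i : (0 < k i)%N by apply: leq_trans (le_ck i).
pose good (A : 'rV[int]_w) :=
  setXn (fun i => [set t : 'I_(k i) | in_window c (k i) (A ord0 i + t%:Z)]).
have good_card A : #|good A| = (c ^ w)%N.
  rewrite cardsXn; under eq_bigr do rewrite card_window //.
  by rewrite prod_nat_const card_ord.
pose shrink (t : {dffun forall i, 'I_(k i)}) (A : 'rV[int]_w) : 'rV[int]_w :=
  \row_i squeeze c (k i) (A ord0 i + (t i)%:Z).
have shrink_le t A B : t \in good A -> t \in good B ->
    vec_le (shrink t A) (shrink t B) -> vec_le A B.
  move=> /setXnP tA /setXnP tB le_s i; move: {tA tB}(tA i) (tB i) (le_s i).
  rewrite !inE !mxE => tA tB /(squeeze_le (k_gt0 i) tA tB).
  by rewrite lerD2r.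
have good_bound t : (#|` [fset A in X | t \in good A]%fset| <= n)%N.
  set G := [fset A in X | t \in good A]%fset.
  have GP A : A \in G -> F A /\ t \in good A.
    by rewrite !inE /= => /andP[/XF].
  (* Equal images are comparable, so the antichain property identifies the originals. *)
  have shrink_inj : {in G &, injective (shrink t)}.
    move=> A B /GP[FA tA] /GP[FB tB] eqs.
    by apply: antiF => //; apply: (shrink_le t) => // i; rewrite eqs.
  have <- : #|` shrink t @` G|%fset = #|` G|%fset by rewrite card_in_imfset.
  suff /card_le_IIP/(_ _ (@subset_refl _ _)) :
    ([set` (shrink t @` G)%fset] #<= `I_n)%card by [].
  apply: bound => [_ _ /imfsetP[A /GP[FA tA] ->] /imfsetP[B /GP[FB tB] ->]|].
    by move=> /(shrink_le _ _ _ tA tB)/antiF->.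
  move=> _ _ /imfsetP[A /GP[FA tA] ->] /imfsetP[B /GP[FB tB] ->] [i [j]].
  rewrite !mxE => -[lei lej]; apply: (freeF A B) => //; exists i, j.
  move: tA tB => /setXnP tA /setXnP tB.
  move: (tA i) (tA j) (tB i) (tB j); rewrite !inE => tAi tAj tBi tBj.
  split; [move: (squeeze_gap (k_gt0 i) tAi tBi lei)|
          move: (squeeze_gap (k_gt0 j) tBj tAj lej)]; lia.
have -> : (#|` X| * c ^ w = \sum_(A <- X) #|good A|)%N.
  under eq_bigr do rewrite good_card.
  by rewrite big_const_seq count_predT iter_addn_0 mulnC.
under eq_bigr do rewrite -sum1_card big_mkcond /=.
(* From here the pairs are counted shift by shift. *)
rewrite exchange_big /=.
apply: leq_trans (_ : \sum_(t : {dffun forall i, 'I_(k i)}) n <= _)%N; last first.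
  rewrite sum_nat_const mulnC card_dep_ffun foldrE big_image /=.
  by under eq_bigr do rewrite card_ord.
apply: leq_sum => t _; rewrite -big_mkcond sum1_count -size_filter.
apply: leq_trans (good_bound t).
apply: uniq_leq_size => [|A]; first by rewrite filter_uniq ?fset_uniq.
by rewrite mem_filter !inE /= andbC.
Qed.

(** The coordinates of each vector sum to 0, so comparable vectors coincide. A crossing would need
    both gaps at [ord0], with opposite signs. *)
Lemma exists_crossing_free_antichain (w : nat) (k : 'I_w.+1 -> nat) :
  (forall i, 0 < k i)%N ->
  exists F : set 'rV[int]_w.+1,
    [/\ antichain F, crossing_free k F &
        (F #= `I_(\prod_(i < w.+1 | (0 < i)%N) k i))%card].
Proof.
move=> k_gt0.
pose vec (t : {dffun forall i : 'I_w, 'I_(k (lift ord0 i))}) : 'rV[int]_w.+1 :=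
  \row_i if unlift ord0 i is Some j then (t j)%:Z else - (\sum_(j < w) (t j)%:Z).
have vec0 t : vec t ord0 ord0 = - (\sum_(j < w) (t j)%:Z) by rewrite mxE unlift_none.
have vecS t j : vec t ord0 (lift ord0 j) = (t j)%:Z by rewrite mxE liftK.
have vec_le_inj s t : vec_le (vec s) (vec t) -> s = t.
  move=> le_st; have le_j j : (s j)%:Z <= (t j)%:Z.
    by rewrite -!vecS.
  (* Coordinate [ord0] carries the negated sum, so it bounds the sum of [t] by that of [s]; no
     [le_j] can then be strict. *)
  have := le_st ord0; rewrite !vec0 lerN2 => le_ts.
  apply/ffunP => j; apply/val_inj/eqP; rewrite -eqz_nat /=; apply/eqP/le_anti.
  rewrite le_j /= -(lerD2r (\sum_(i < w | i != j) (t i)%:Z)).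
  move: le_ts; rewrite (bigD1 j) //= [leRHS](bigD1 j) //= => /le_trans; apply.
  by rewrite lerD2l ler_sum.
have small s t i : (k i)%:Z <= vec s ord0 i - vec t ord0 i -> i = ord0.
  case: (unliftP ord0 i) => [j ->|//]; rewrite !vecS.
  have := ltn_ord (s j); lia.
have vec_inj : injective vec.
  by move=> s t eqv; apply: vec_le_inj => i; rewrite eqv.
exists [set` [fset vec t | t in predT]%fset]%classic.
split.
- by move=> _ _ /imfsetP[s _ ->] /imfsetP[t _ ->] /vec_le_inj ->.
- move=> _ _ /imfsetP[s _ ->] /imfsetP[t _ ->] [i [j [lei lej]]].
  have i0 := small _ _ _ lei; have j0 := small _ _ _ lej.
  move: lei lej; rewrite i0 j0.
  have := k_gt0 ord0; lia.
apply/card_eq_fsetP; rewrite card_imfset //= -cardE.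
rewrite card_dep_ffun foldrE big_image /= [RHS]big_mkcond big_ord_recl /= mul1n.
by apply: eq_bigr => i _; rewrite card_ord.
Qed.

Theorem proposition15 :
  (forall k w : nat, (1 <= k)%N -> (1 <= w)%N ->
     max_size (fun _ : 'I_w => k) (k ^ (w - 1))%N)
  <->
  (forall (w : nat) (k : 'I_w -> nat), (1 <= w)%N ->
     (forall i : 'I_w, (1 <= k i)%N) ->
     (forall i j : 'I_w, (i <= j)%N -> (k i <= k j)%N) ->
     max_size k (\prod_(i < w | (0 < i)%N) k i)%N).
Proof.
split=> [max_eq [//|w] k _ k_gt0 k_mono|max_k k [//|w] k_gt0 _].
  split; first exact: exists_crossing_free_antichain.
  move=> F antiF freeF; apply/card_le_IIP => X XF.
  have [_ bound] := max_eq (k ord0) w.+1 (k_gt0 _) isT.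
  have := crossing_free_card_mul (k_gt0 ord0) (fun i => k_mono ord0 i isT)
    bound antiF freeF XF.
  (* With [c = k ord0] and [n = c ^ w] in dimension [w.+1], the factor [c ^ w.+1] cancels from both
     sides, one [c] coming from the first factor of the product. *)
  rewrite subn1 /= expnSr [X in (_ <= _ * X)%N]big_ord_recl /=.
  rewrite [(k ord0 ^ w * (_ * _))%N]mulnA mulnC leq_pmul2l; last first.
    by rewrite muln_gt0 expn_gt0 k_gt0.
  by rewrite [X in _ -> (_ <= X)%N]big_mkcond big_ord_recl /= mul1n.
have := max_k w.+1 (fun=> k) isT (fun=> k_gt0) (fun _ _ _ => leqnn k).
by rewrite big_mkcond big_ord_recl /= mul1n prod_nat_const card_ord subn1.
Qed.
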